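(* Let $R = k[x_1,\dots,x_n]$ be a polynomial ring over a field $k$. Let $I$ be a monomial ideal of $R$ and let $x$ be a variable in $R$ (one of $x_1,\dots,x_n$). Then (i) $\operatorname{depth} R/I \in \{ \operatorname{depth} R/(I:x),\ \operatorname{depth} R/(I,x)\}$; (ii) $\operatorname{reg} R/I \in \{\operatorname{reg} R/(I:x)+1,\ \operatorname{reg} R/(I,x)\}$.
   Context: $R$ has the standard grading and $\mathfrak m=(x_1,\dots,x_n)$. For a finitely generated graded $R$-module $M$ with local cohomology modules $H^i_{\mathfrak m}(M)$, $\operatorname{depth} M := \min\{ i \mid H^i_{\mathfrak m}(M) \neq 0\}$ and $\operatorname{reg} M := \max\{i+j \mid H^i_{\mathfrak m}(M)_j \neq 0\}$ (Castelnuovo-Mumford regularity). By the usual convention the zero module has depth $+\infty$ and regularity $-\infty$. $I:x=\{g\in R\mid gx\in I\}$ and $(I,x)=I+(x)$. *)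

(* Defs.v *)
From HB Require Import structures.
From mathcomp Require Import all_boot all_order all_algebra.
From mathcomp Require Import generic_quotient ring_quotient mpoly.
From mathcomp Require Import boolp classical_sets constructive_ereal.
From mathcomp Require Import zify ring.

Set Implicit Arguments.
Unset Strict Implicit.
Unset Printing Implicit Defensive.

Import Order.TTheory GRing.Theory Num.Theory.
Local Open Scope ring_scope.
Local Open Scope quotient_scope.

(* The library quotient [Quotient.quot N] only carries a [zmodType] structure (and a
   ring structure when [N] is a proper ideal); here [N] may be everything. *)
Section QuotientModule.
Variables (A : pzRingType) (V : lmodType A) (N : submodClosed V).

(* [submodClosed V] does not inherit from [zmodClosed V]. *)
Definition submod_pred : {pred V} := [pred v | v \in N].
Fact submod_pred_zmod_closed : zmod_closed submod_pred.
Proof. exact: GRing.submod_closedB (GRing.submodClosedP N). Qed.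
HB.instance Definition _ := GRing.isZmodClosed.Build V submod_pred
  submod_pred_zmod_closed.

Definition quotm : Type := Quotient.quot submod_pred.
HB.instance Definition _ := GRing.Zmodule.on quotm.

Definition quotm_pi (v : V) : quotm := \pi_(Quotient.quot submod_pred) v.

Lemma quotm_eqP (u v : V) : reflect (quotm_pi u = quotm_pi v) (u - v \in N).
Proof.
have -> : (u - v \in N) = (u - v \in submod_pred) by [].
by rewrite Quotient.idealrBE; exact: eqP.
Qed.

Lemma quotm_surj (q : quotm) : exists v, q = quotm_pi v.
Proof. by exists (repr (q : Quotient.quot submod_pred)); rewrite /quotm_pi reprK. Qed.

Lemma quotm_piD (u v : V) : quotm_pi (u + v) = quotm_pi u + quotm_pi v.
Proof. exact: Quotient.pi_add. Qed.

Definition quotm_scale (a : A) (q : quotm) : quotm := quotm_pi (a *: repr (q : Quotient.quot submod_pred)).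

Lemma quotm_piZ (a : A) (v : V) : quotm_pi (a *: v) = quotm_scale a (quotm_pi v).
Proof.
apply/quotm_eqP; rewrite -scalerBr rpredZ //.
by apply/quotm_eqP; rewrite /quotm_pi reprK.
Qed.

Fact quotm_scalerA a b q : quotm_scale a (quotm_scale b q) = quotm_scale (a * b) q.
Proof. by have [v ->] := quotm_surj q; rewrite -!quotm_piZ scalerA. Qed.

Fact quotm_scale1r : left_id 1 quotm_scale.
Proof. by move=> q; have [v ->] := quotm_surj q; rewrite -quotm_piZ scale1r. Qed.

Fact quotm_scalerDr : right_distributive quotm_scale +%R.
Proof.
move=> a p q; have [u ->] := quotm_surj p; have [v ->] := quotm_surj q.
by rewrite -quotm_piD -!quotm_piZ scalerDr quotm_piD.
Qed.

Fact quotm_scalerDl q : {morph quotm_scale^~ q : a b / a + b}.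
Proof.
by move=> a b; have [v ->] := quotm_surj q; rewrite -!quotm_piZ scalerDl quotm_piD.
Qed.

HB.instance Definition _ := GRing.Zmodule_isLmodule.Build A quotm
  quotm_scalerA quotm_scale1r quotm_scalerDr quotm_scalerDl.

End QuotientModule.

(* The localization M_f: classes of pairs (m, a), standing for m / f^a. *)
Section Localization.
Variables (A : comNzRingType) (M : lmodType A) (f : A).

Definition loc_rel (u v : M * nat) : bool :=
  `[< exists t : nat, f ^+ t *: (f ^+ v.2 *: u.1 - f ^+ u.2 *: v.1) = 0 >].

Fact loc_rel_refl : reflexive loc_rel.
Proof. by move=> u; apply/asboolP; exists 0%N; rewrite subrr scaler0. Qed.

Fact loc_rel_sym : ssrbool.symmetric loc_rel.
Proof.
suff H u v : loc_rel u v -> loc_rel v u by move=> u v; apply/idP/idP; apply: H.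
move=> /asboolP[t tE]; apply/asboolP; exists t.
by rewrite -opprB scalerN tE oppr0.
Qed.

Fact loc_rel_trans : transitive loc_rel.
Proof.
move=> v u w /asboolP[s sE] /asboolP[t tE]; apply/asboolP.
exists (s + t + v.2)%N.
have -> : f ^+ (s + t + v.2) *: (f ^+ w.2 *: u.1 - f ^+ u.2 *: w.1) =
    f ^+ (t + w.2) *: (f ^+ s *: (f ^+ v.2 *: u.1 - f ^+ u.2 *: v.1)) +
    f ^+ (s + u.2) *: (f ^+ t *: (f ^+ w.2 *: v.1 - f ^+ v.2 *: w.1)).
  rewrite !scalerBr !scalerA -!exprD addrA.
  have -> : (s + t + v.2 + w.2 = t + w.2 + s + v.2)%N by lia.
  have -> : (s + t + v.2 + u.2 = s + u.2 + t + v.2)%N by lia.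
  have -> : (s + u.2 + t + w.2 = t + w.2 + s + u.2)%N by lia.
  by rewrite subrK.
by rewrite sE tE !scaler0 addr0.
Qed.

Canonical loc_equiv := EquivRel loc_rel loc_rel_refl loc_rel_sym loc_rel_trans.

Definition locm : Type := {eq_quot loc_rel}.
HB.instance Definition _ := Choice.on locm.
HB.instance Definition _ := EqQuotient.on locm.

Definition frac (m : M) (a : nat) : locm := \pi_locm (m, a).

Lemma frac_eqP (m m' : M) (a b : nat) :
  frac m a = frac m' b <->
  exists t : nat, f ^+ t *: (f ^+ b *: m - f ^+ a *: m') = 0.
Proof.
split; first by move=> /eqP; rewrite /frac piE => /asboolP.
by move=> H; apply/eqP; rewrite /frac piE; apply/asboolP.
Qed.

Lemma frac_surj (u : locm) : exists m a, u = frac m a.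
Proof. by exists (repr u).1, (repr u).2; rewrite /frac -surjective_pairing reprK. Qed.


Fact loc_scaleE (s : nat) (m : M) (a : nat) : frac (f ^+ s *: m) (a + s) = frac m a.
Proof.
apply/frac_eqP; exists 0%N.
by rewrite scalerA -exprD subrr scaler0.
Qed.

Definition loc_add (u v : locm) : locm :=
  frac (f ^+ (repr v).2 *: (repr u).1 + f ^+ (repr u).2 *: (repr v).1)
       ((repr u).2 + (repr v).2).

Definition loc_opp (u : locm) : locm := frac (- (repr u).1) (repr u).2.

Lemma loc_addE (m m' : M) (a b : nat) :
  loc_add (frac m a) (frac m' b) = frac (f ^+ b *: m + f ^+ a *: m') (a + b).
Proof.
have /frac_eqP[s] : frac (repr (frac m a)).1 (repr (frac m a)).2 = frac m a.
  by rewrite /frac -surjective_pairing reprK.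
have /frac_eqP[t] : frac (repr (frac m' b)).1 (repr (frac m' b)).2 = frac m' b.
  by rewrite /frac -surjective_pairing reprK.
rewrite /loc_add.
case: (repr (frac m a)) => p c; case: (repr (frac m' b)) => q d /= tE sE.
apply/frac_eqP; exists (s + t)%N.
have -> : f ^+ (s + t) *: (f ^+ (a + b) *: (f ^+ d *: p + f ^+ c *: q) -
             f ^+ (c + d) *: (f ^+ b *: m + f ^+ a *: m')) =
   f ^+ (t + b + d) *: (f ^+ s *: (f ^+ a *: p - f ^+ c *: m)) +
   f ^+ (s + a + c) *: (f ^+ t *: (f ^+ b *: q - f ^+ d *: m')).
  rewrite !(scalerBr, scalerDr) !scalerA -!exprD opprD addrACA.
  by congr ((_ *: _ - _ *: _) + (_ *: _ - _ *: _)); congr (f ^+ _); lia.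
by rewrite sE tE !scaler0 addr0.
Qed.

Lemma loc_oppE (m : M) (a : nat) : loc_opp (frac m a) = frac (- m) a.
Proof.
have /frac_eqP[s] : frac (repr (frac m a)).1 (repr (frac m a)).2 = frac m a.
  by rewrite /frac -surjective_pairing reprK.
rewrite /loc_opp; case: (repr (frac m a)) => p c /= sE.
apply/frac_eqP; exists s.
by rewrite !scalerN -opprD scalerN sE oppr0.
Qed.

Fact loc_addA : associative loc_add.
Proof.
move=> u v w; have [p [a ->]] := frac_surj u; have [q [b ->]] := frac_surj v.
have [r [c ->]] := frac_surj w; rewrite !loc_addE addnA; congr frac.
by rewrite !scalerDr !scalerA -!exprD addrA [(c + b)%N]addnC [(c + a)%N]addnC.
Qed.

Fact loc_addC : commutative loc_add.
Proof.
move=> u v; have [p [a ->]] := frac_surj u; have [q [b ->]] := frac_surj v.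
by rewrite !loc_addE addnC addrC.
Qed.

Fact loc_add0 : left_id (frac 0 0) loc_add.
Proof.
move=> u; have [p [a ->]] := frac_surj u.
by rewrite loc_addE scaler0 add0r expr0 scale1r.
Qed.

Fact loc_addN : left_inverse (frac 0 0) loc_opp loc_add.
Proof.
move=> u; have [p [a ->]] := frac_surj u.
rewrite loc_oppE loc_addE scalerN addNr.
by apply/frac_eqP; exists 0%N; rewrite !scaler0 subrr scaler0.
Qed.

HB.instance Definition _ := GRing.isZmodule.Build locm
  loc_addA loc_addC loc_add0 loc_addN.

End Localization.

(* For g = f * h, the natural map M_f -> M_g, i.e. m / f^a |-> h^a m / g^a. *)
Definition loc_map (A : comNzRingType) (M : lmodType A) (f h g : A)
    (u : locm M f) : locm M g :=
  frac g (h ^+ (repr u).2 *: (repr u).1) (repr u).2.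

Lemma loc_mapE (A : comNzRingType) (M : lmodType A) (f h g : A) (m : M) (a : nat) :
  g = f * h -> loc_map h g (frac f m a) = frac g (h ^+ a *: m) a.
Proof.
move=> ->; have /frac_eqP[s] :
    frac f (repr (frac f m a)).1 (repr (frac f m a)).2 = frac f m a.
  by rewrite /frac -surjective_pairing reprK.
rewrite /loc_map; case: (repr (frac f m a)) => p c /= sE.
apply/frac_eqP; exists s.
have -> : (f * h) ^+ s *: ((f * h) ^+ a *: (h ^+ c *: p) -
            (f * h) ^+ c *: (h ^+ a *: m)) =
   h ^+ (s + a + c) *: (f ^+ s *: (f ^+ a *: p - f ^+ c *: m)).
  rewrite !scalerBr !scalerA !exprMn !exprD.
  by congr (_ *: _ - _ *: _); ring.
by rewrite sE scaler0.
Qed.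

(* The Cech complex of M on the variables x_1, ..., x_n: its term in
   cohomological degree i is the direct sum of the localizations of M at the
   products of i distinct variables.  Its cohomology is H^i_m(M). *)
Section LocalCohomology.
Variables (k : fieldType) (n : nat).
Local Notation R := {mpoly k[n]}.

Definition xprod (F : {set 'I_n}) : R := \prod_(i in F) 'X_i.

Lemma xprodD1 (F : {set 'I_n}) (i : 'I_n) :
  i \in F -> xprod F = xprod (F :\ i) * 'X_i.
Proof. by move=> iF; rewrite /xprod (big_setD1 i) //= mulrC. Qed.

Variable M : lmodType R.

(* All cohomological degrees at once. *)
Definition cochain : Type := forall F : {set 'I_n}, locm M (xprod F).

Definition cech_d (c : cochain) : cochain := fun G =>
  \sum_(i in G) loc_map 'X_i (xprod G) (c (G :\ i)) *~
    (-1) ^+ #|[set l in G | (l < i)%N]|.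

Definition cocycle (i : nat) (c : cochain) : Prop :=
  (forall F : {set 'I_n}, #|F| != i -> c F = 0) /\
  (forall F : {set 'I_n}, cech_d c F = 0).

Definition coboundary (i : nat) (c : cochain) : Prop :=
  exists b : cochain,
    (forall F : {set 'I_n}, #|F|.+1 != i -> b F = 0) /\
    (forall F : {set 'I_n}, c F = cech_d b F).

(* H^i_m(M) <> 0 *)
Definition lc_neq0 (i : nat) : Prop :=
  exists c : cochain, cocycle i c /\ ~ coboundary i c.

(* As a minimum of a set of natural numbers, +oo if this set is empty. *)
Definition depth : \bar int :=
  infimum +oo%E [set (i%:Z)%:E%E | i in [set i : nat | lc_neq0 i]]%classic.

Section Graded.
(* gr j is the homogeneous component M_j. *)
Variable gr : int -> set M.

(* m / x_F^a has degree deg m - a |F|. *)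
Definition loc_gr (F : {set 'I_n}) (j : int) (u : locm M (xprod F)) : Prop :=
  exists (m : M) (a : nat), gr (j + (a * #|F|)%:Z) m /\ u = frac (xprod F) m a.

(* H^i_m(M)_j <> 0 *)
Definition lc_gr_neq0 (i : nat) (j : int) : Prop :=
  exists c : cochain,
    [/\ cocycle i c, forall F : {set 'I_n}, loc_gr j (c F) & ~ coboundary i c].

(* The maximum of the set when it is bounded above, -oo if it is empty. *)
Definition reg : \bar int :=
  supremum -oo%E
    [set (ij.1%:Z + ij.2)%:E%E
       | ij in [set ij : nat * int | lc_gr_neq0 ij.1 ij.2]]%classic.

End Graded.
End LocalCohomology.

(* Ideals of A are the submodules of A^o.  [submodClosed] asks for a boolean
   membership predicate, which classically is no restriction. *)
Section Ideals.
Variables (A : comNzRingType) (I : submodClosed A^o) (x : A).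

Definition colon_pred : {pred A^o} := [pred g : A | (g * x : A^o) \in I].

Fact colon_submod_closed : submod_closed colon_pred.
Proof.
split=> [|a u v]; first by rewrite inE mul0r rpred0.
rewrite !inE => uI vI; rewrite mulrDl -mulrA.
by apply: rpredD => //; exact: (rpredZ a uI).
Qed.
HB.instance Definition _ := GRing.isSubmodClosed.Build A A^o colon_pred
  (GRing.submod_closed_semi colon_submod_closed).

Definition colon : submodClosed A^o := colon_pred.

Definition adjoin_pred : {pred A^o} :=
  [pred g : A | `[< exists f h : A, (f : A^o) \in I /\ g = f + h * x >]].

Fact adjoin_submod_closed : submod_closed adjoin_pred.
Proof.
split=> [|a u v].
  by apply/asboolP; exists 0, 0; rewrite mul0r addr0 rpred0.
move=> /asboolP[f [h [fI ->]]] /asboolP[f' [h' [fI' ->]]].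
apply/asboolP; exists (a * f + f'), (a * h + h'); split.
  by apply: rpredD => //; exact: (rpredZ a fI).
by rewrite mulrDl -mulrA addrACA -mulrDr.
Qed.
HB.instance Definition _ := GRing.isSubmodClosed.Build A A^o adjoin_pred
  (GRing.submod_closed_semi adjoin_submod_closed).

Definition adjoin : submodClosed A^o := adjoin_pred.

End Ideals.

Section MonomialIdeals.
Variables (k : fieldType) (n : nat).
Local Notation R := {mpoly k[n]}.

Definition monomial_ideal (I : submodClosed R^o) : Prop :=
  exists S : set 'X_{1..n}, forall f : R,
    (f : R^o) \in I <->
    exists s : seq (R * 'X_{1..n}),
      (forall p, p \in s -> S p.2) /\ f = \sum_(p <- s) p.1 * 'X_[p.2].

Definition mpoly_gr (j : int) : set R := fun f =>
  match j with
  | Posz d => f \is d.-homog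
  | Negz _ => f = 0
  end.

(* The grading of R / I induced by the standard grading of R. *)
Definition quot_gr (I : submodClosed R^o) (j : int) : set (quotm I) :=
  [set quotm_pi I f | f in mpoly_gr j]%classic.

End MonomialIdeals.

Arguments quot_gr {k n} I j _.

(* Main.v *)
Require Import Defs.
From HB Require Import structures.
From mathcomp Require Import all_boot all_order all_algebra.
From mathcomp Require Import generic_quotient ring_quotient mpoly.
From mathcomp Require Import boolp classical_sets constructive_ereal.
From mathcomp Require Import zify.

Set Implicit Arguments.
Unset Strict Implicit.
Unset Printing Implicit Defensive.

Import Order.TTheory GRing.Theory Num.Theory.
Local Open Scope ring_scope.

(** Write A = R/(I:x), B = R/I, C = R/(I,x).  The exact sequence
    0 -> A(-1) -> B -> C -> 0, whose first map is multiplication by x, gives a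
    long exact sequence of local cohomology, and this determines depth and
    regularity up to one missing comparison of A with B.  For monomial ideals
    the comparison is that every nonzero H^i(A)_j forces H^i(B)_j or
    H^i(B)_(j+1) to be nonzero.  Hence depth B <= depth A and reg A <= reg B;
    with the three inequalities read off the long exact sequence the two
    dichotomies become arithmetic ([depth_dichotomy], [reg_dichotomy]).

    Everything is made explicit by splitting the Cech complex of R/I into
    multidegrees a in Z^n.  The localization of R/I at x_F is a k-vector space
    with at most one basis vector in each multidegree; [strand I a] is the set
    of those F for which there is one.  The degree-a part of the Cech complex is
    then the complex of k-valued functions on the family [strand I a] of subsets
    of the set of variables, with the simplicial differential, and H^i(R/I)_j is
    nonzero exactly when one of these complexes with |a| = j has cohomology in
    degree i ([lc_neq0P], [lc_gr_neq0P]).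

    Let e be the multidegree of x.  The strands of A and C come from those of B:
    - if b_x <> 0, then A in degree b - e and B in degree b have the same
      strand, while C has an empty strand in degree b;
    - if b_x = 0, the strand of B in degree b is the disjoint union of its
      members that contain x, the strand of A in degree b - e, and of those that
      do not, the strand of C in degree b.
    In the second case the sets containing x carry a subcomplex and the others
    the quotient complex, so the long exact sequence is that of a finite complex
    cut in two ([subset_H_middle], [subset_H_right], [subset_H_left]).  The
    comparison of A with B holds because the strand of A in degree a is that of
    B in degree a if a_x < 0 and in degree a + e otherwise ([strand_colon]). *)

(** * Complexes of functions on a family of subsets *)

Section SubsetComplex.
Variables (n : nat) (V : zmodType).
Implicit Types (D : pred {set 'I_n}) (F G : {set 'I_n}).
Implicit Types (b c : {set 'I_n} -> V).

Definition incidence G (l : 'I_n) : int := (-1) ^+ #|[set m in G | (m < l)%N]|.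

Definition simplex_d c G : V := \sum_(l in G) c (G :\ l) *~ incidence G l.

Definition subset_d D c G : V := if D G then simplex_d c G else 0.

Definition cochain_on D (i : nat) c : Prop :=
  forall F, ~~ (D F && (#|F| == i)) -> c F = 0.

Definition subset_cocycle D i c : Prop :=
  cochain_on D i c /\ forall G, subset_d D c G = 0.

Definition subset_coboundary D i c : Prop :=
  exists b, (forall F, ~~ (D F && (#|F|.+1 == i)) -> b F = 0) /\
            forall G, c G = subset_d D b G.

Definition subset_H_neq0 D (i : nat) : Prop :=
  exists c, subset_cocycle D i c /\ ~ subset_coboundary D i c.

(** The condition under which cutting the simplicial differential down to D
    still gives a complex: between two members of D that differ by two points,
    both intermediate sets are available to cancel each other. *)
Definition interval_closed D : Prop :=
  forall F F' G, F \subset F' -> F' \subset G -> D F -> D G -> D F'.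

Lemma incidence_setD1_gt G (l m : 'I_n) : l \in G -> (l < m)%N ->
  incidence (G :\ l) m = - incidence G m.
Proof.
move=> lG lm; rewrite /incidence.
have -> : [set x in G :\ l | (x < m)%N] = [set x in G | (x < m)%N] :\ l.
  by apply/setP=> x; rewrite !inE andbA.
have := cardsD1 l [set x in G | (x < m)%N]; rewrite inE lG lm => ->.
by rewrite exprS mulN1r opprK.
Qed.

Lemma incidence_setD1_lt G (l m : 'I_n) : (m < l)%N ->
  incidence (G :\ l) m = incidence G m.
Proof.
move=> lm; rewrite /incidence; congr (_ ^+ #|pred_of_set _|).
apply/setP=> x; rewrite !inE -andbA; case: eqP => //= ->.
by rewrite ltnNge (ltnW lm) andbF.
Qed.

(** Removing l and then m, or m and then l, leaves the same set; exactly one of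
    the two orders changes the sign of the second incidence number.  The double
    sum is split by the order of the two points instead of being shown equal to
    its own opposite, which would not suffice in characteristic 2. *)
Lemma simplex_d_comp c G : simplex_d (simplex_d c) G = 0.
Proof.
pose t l m : V := c (G :\ l :\ m) *~ (incidence G l * incidence G m).
have tC l m : t l m = t m l by rewrite /t mulrC finset.setDDl finset.setUC -finset.setDDl.
have -> : simplex_d (simplex_d c) G =
    \sum_(l in G) \sum_(m in G | (m < l)%N) t l m -
    \sum_(l in G) \sum_(m in G | (l < m)%N) t l m.
  rewrite -sumrB; apply: eq_bigr => l lG; rewrite mulrz_suml.
  rewrite (bigID (fun m : 'I_n => (m < l)%N)) /= -[in RHS]sumrN.
  congr (_ + _); (apply: eq_big => [m|m /andP[]]; rewrite in_setD1).
  - by case: eqP => [->|]; rewrite ?ltnn ?andbF.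
  - move=> /andP[ml mG] lt_ml.
    by rewrite incidence_setD1_lt // -mulrzA mulrC.
  - by rewrite -leqNgt ltn_neqAle eq_sym -val_eqE /=; case: eqP; rewrite ?andbF.
  - move=> /andP[ml mG]; rewrite -leqNgt leq_eqVlt eq_sym val_eqE (negPf ml) /=.
    by move=> lt_lm; rewrite incidence_setD1_gt // -mulrzA mulNr mulrNz mulrC.
apply/eqP; rewrite subr_eq0; apply/eqP.
rewrite [RHS](exchange_big_dep (mem G)) /=; last by move=> l m _ /andP[].
apply: eq_bigr => l lG; apply: eq_big => [m|m _]; last by rewrite tC.
by rewrite lG.
Qed.

Lemma subset_d_comp D b G :
  interval_closed D -> (forall F, ~~ D F -> b F = 0) ->
  subset_d D (subset_d D b) G = 0.
Proof.
move=> Dint b0; rewrite {1}/subset_d; case: ifP => // DG.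
rewrite -(simplex_d_comp b G); apply: eq_bigr => l lG; congr (_ *~ _).
rewrite /subset_d; case: ifPn => // nD; rewrite /simplex_d big1 // => m _.
rewrite b0 ?mul0rz //; apply: contra nD => Dlm.
by apply: Dint Dlm DG; rewrite finset.subsetDl.
Qed.

Lemma subset_d_support D i b :
  (forall F, ~~ (D F && (#|F|.+1 == i)) -> b F = 0) ->
  cochain_on D i (subset_d D b).
Proof.
move=> b0 F; rewrite /subset_d; case: ifP => //= DF nF.
rewrite /simplex_d big1 // => l lF; rewrite b0 ?mul0rz // negb_and.
by apply/orP; right; apply: contra nF => /eqP <-; rewrite (cardsD1 l F) lF.
Qed.

Lemma subset_d0 D G : subset_d D (fun=> 0) G = 0.
Proof.
by rewrite /subset_d /simplex_d big1 ?if_same // => l _; rewrite mul0rz.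
Qed.

Lemma subset_dB D b c G :
  subset_d D (fun F => b F - c F) G = subset_d D b G - subset_d D c G.
Proof.
rewrite /subset_d; case: ifP => _; last by rewrite subr0.
by rewrite -sumrB; apply: eq_bigr => l _; rewrite mulrzBl.
Qed.

Lemma subset_dD D b c G :
  subset_d D (fun F => b F + c F) G = subset_d D b G + subset_d D c G.
Proof.
rewrite /subset_d; case: ifP => _; last by rewrite addr0.
by rewrite -big_split; apply: eq_bigr => l _; rewrite mulrzDl.
Qed.

Lemma eq_subset_d D b c : b =1 c -> subset_d D b =1 subset_d D c.
Proof.
move=> bc G; rewrite /subset_d; case: ifP => // _.
by apply: eq_bigr => l _; rewrite bc.
Qed.

Lemma eq_subset_H_neq0 D D' i : D =1 D' -> subset_H_neq0 D i -> subset_H_neq0 D' i.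
Proof. by move=> /funext->. Qed.

Lemma subset_H_neq0_pred0 D i : D =1 pred0 -> ~ subset_H_neq0 D i.
Proof.
move=> D0 [c [[c0 _] []]]; exists (fun=> 0); split=> // G.
by rewrite subset_d0 c0 ?D0.
Qed.

Section LongExactSequence.
Variables (D : pred {set 'I_n}) (x : 'I_n).
Hypothesis Dint : interval_closed D.

Definition with_pt : pred {set 'I_n} := fun F => D F && (x \in F).
Definition without_pt : pred {set 'I_n} := fun F => D F && (x \notin F).

Let restr c F := if x \in F then 0 else c F.

Lemma subset_d_with c G : (forall F, x \notin F -> c F = 0) ->
  subset_d D c G = subset_d with_pt c G.
Proof.
move=> c0; rewrite /subset_d /with_pt; case: (boolP (x \in G)) => xG.
  by rewrite andbT.
rewrite andbF; case: ifP => // _; rewrite /simplex_d big1 // => l _.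
by rewrite c0 ?mul0rz // !inE negb_and xG orbT.
Qed.

Lemma subset_d_without c G :
  subset_d without_pt c G = restr (subset_d D c) G.
Proof. by rewrite /restr /subset_d /without_pt; case: (x \in G); rewrite ?andbF ?andbT. Qed.

Lemma eq_subset_d_without b c : (forall F, x \notin F -> b F = c F) ->
  subset_d without_pt b =1 subset_d without_pt c.
Proof.
move=> bc G; rewrite /subset_d /without_pt; case: ifP => // /andP[_ xG].
by apply: eq_bigr => l _; rewrite bc // !inE negb_and xG orbT.
Qed.

(** The functions supported on the members of D that contain x form a
    subcomplex, those on the other members the quotient.  The next three lemmas
    are exactness of the long cohomology sequence at its three kinds of terms,
    in the form: a nonzero group has a nonzero neighbour. *)
Lemma subset_H_middle i :
  subset_H_neq0 D i -> subset_H_neq0 with_pt i \/ subset_H_neq0 without_pt i.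
Proof.
move=> [c [[c0 dc] ncb]].
(* If the image of c in the quotient complex is not a coboundary, it is the
   required class; otherwise c can be moved into the subcomplex. *)
have [[b [b0 cb]]|ncb'] := pselect (subset_coboundary without_pt i (restr c)); last first.
  right; exists (restr c); split=> //; split.
    move=> F; rewrite /restr /without_pt; case: ifP => // xF; rewrite andbT.
    exact: c0.
  move=> G; rewrite (eq_subset_d_without (c := c)).
    by rewrite subset_d_without /restr dc; case: ifP.
  by move=> F /negPf; rewrite /restr => ->.
have b0D F : ~~ (D F && (#|F|.+1 == i)) -> b F = 0.
  by move=> /negP nF; apply: b0; apply/negP=> /andP[/andP[DF _] Fi]; apply: nF; rewrite DF.
have b0D' F : ~~ D F -> b F = 0 by move=> nD; apply: b0D; rewrite (negPf nD).
pose c' F := c F - subset_d D b F.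
have c'x F : x \notin F -> c' F = 0.
  move=> xF; move: (cb F); rewrite subset_d_without /restr (negPf xF) /c' => ->.
  by rewrite subrr.
have c'0 : cochain_on D i c'.
  by move=> F nF; rewrite /c' c0 // (subset_d_support b0D) ?subrr.
left; exists c'; split.
  split=> [F|G].
    rewrite /with_pt; case: (boolP (x \in F)) => [_|xF _]; last exact: c'x.
    by rewrite andbT; apply: c'0.
  by rewrite -subset_d_with // subset_dB dc subset_d_comp // subrr.
move=> [e [e0 c'e]]; apply: ncb; exists (fun F => e F + b F); split=> [F nF|G].
  by rewrite b0D // e0 ?addr0 //; apply: contra nF => /andP[/andP[-> _] ->].
have ex F : x \notin F -> e F = 0.
  by move=> /negPf xF; apply: e0; rewrite /with_pt xF andbF.
by rewrite subset_dD subset_d_with // -c'e subrK.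
Qed.

Lemma subset_H_right i :
  subset_H_neq0 without_pt i -> subset_H_neq0 D i \/ subset_H_neq0 with_pt i.+1.
Proof.
move=> [c [[c0 dc] ncb]].
have c0D : cochain_on D i c.
  move=> F nF; apply: c0; apply: contra nF => /andP[/andP[-> _] ->]; by [].
have c0D' F : ~~ D F -> c F = 0 by move=> nD; apply: c0D; rewrite (negPf nD).
have dcx F : x \notin F -> subset_d D c F = 0.
  by move=> xF; move: (dc F); rewrite subset_d_without /restr (negPf xF).
(* The connecting map sends c to its differential in the whole complex. *)
have [[b [b0 cb]]|ncb'] := pselect (subset_coboundary with_pt i.+1 (subset_d D c)); last first.
  right; exists (subset_d D c); split=> //; split=> [F|G].
    rewrite /with_pt; case: (boolP (x \in F)) => [xF|xF _]; last exact: dcx.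
    by rewrite andbT; apply: subset_d_support => E nE; apply: c0D; rewrite -eqSS.
  by rewrite -subset_d_with // subset_d_comp.
have bx F : x \notin F -> b F = 0.
  by move=> /negPf xF; apply: b0; rewrite /with_pt xF andbF.
left; exists (fun F => c F - b F); split.
  split=> [F nF|G]; last by rewrite subset_dB cb -subset_d_with // subrr.
  rewrite c0D // b0 ?subrr //; apply: contra nF; rewrite eqSS.
  by case/andP=> /andP[-> _] ->.
move=> [e [e0 ce]]; apply: ncb; exists (restr e); split=> [F|G].
  rewrite /restr /without_pt; case: ifP => // xF; rewrite andbT; exact: e0.
rewrite (eq_subset_d_without (c := e)); last first.
  by move=> F /negPf; rewrite /restr => ->.
rewrite subset_d_without /restr -ce; case: ifP => xG.
  by apply: c0; rewrite /without_pt xG andbF.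
by rewrite bx ?subr0 ?xG.
Qed.

Lemma subset_H_left i :
  subset_H_neq0 with_pt i ->
  subset_H_neq0 D i \/ exists2 j, i = j.+1 & subset_H_neq0 without_pt j.
Proof.
move=> [c [[c0 dc] ncb]].
have cx F : x \notin F -> c F = 0.
  by move=> /negPf xF; apply: c0; rewrite /with_pt xF andbF.
have c0D : cochain_on D i c.
  by move=> F nF; apply: c0; apply: contra nF => /andP[/andP[-> _] ->].
have [[b [b0 cb]]|ncb'] := pselect (subset_coboundary D i c); last first.
  by left; exists c; split=> //; split=> // G; rewrite subset_d_with.
have b0D' F : ~~ D F -> b F = 0 by move=> nD; apply: b0; rewrite (negPf nD).
case: i => [|j] in c0 ncb c0D b0 *.
  case: ncb; exists b; split=> [F _|G]; first by apply: b0; rewrite andbF.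
  have b00 F : b F = 0 by apply: b0; rewrite andbF.
  by rewrite cb !(@eq_subset_d _ b (fun=> 0)) // !subset_d0.
right; exists j => //; exists (restr b); split; first split=> [F|G].
- by rewrite /restr /without_pt; case: ifP => // xF; rewrite andbT; exact: b0.
- rewrite (eq_subset_d_without (c := b)); last first.
    by move=> F /negPf; rewrite /restr => ->.
  by rewrite subset_d_without /restr -cb; case: ifP => // /negbT; exact: cx.
move=> [e [e0 be]]; apply: ncb; exists (fun F => b F - subset_d D e F).
have e0D F : ~~ D F -> e F = 0 by move=> nD; apply: e0; rewrite /without_pt (negPf nD).
have dx F : x \notin F -> b F - subset_d D e F = 0.
  move=> xF; move: (be F); rewrite subset_d_without /restr (negPf xF) => ->.
  by rewrite subrr.
split=> [F|G]; last by rewrite -subset_d_with // subset_dB subset_d_comp // subr0.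
rewrite /with_pt; case: (boolP (x \in F)) => [xF|xF _]; last exact: dx.
rewrite andbT => nF; rewrite b0 // (@subset_d_support _ j) ?subrr //.
move=> E nE; apply: e0; apply: contra nE; by case/andP=> /andP[-> _] ->.
Qed.

End LongExactSequence.
End SubsetComplex.

(** * Multidegrees *)

Section Multidegrees.
Variables (k : fieldType) (n : nat).
Local Notation R := {mpoly k[n]}.
Local Notation Zn := {ffun 'I_n -> int}.
Implicit Types (f g : R) (a b : Zn) (m : 'X_{1..n}) (F G : {set 'I_n}).

Definition zexp m : Zn := [ffun l => (m l)%:Z].

Definition zdeg a : int := \sum_l a l.

(** The coefficient of a polynomial at an exponent vector with possibly negative
    entries, so that a class f / x_F^N can be read in degree a off the exponent
    a + N 1_F of f, whether or not that exponent is one of a monomial of R. *)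
Definition zcoeff f a : k :=
  let m := [multinom `|a l|%N | l < n] in if a == zexp m then f@_m else 0.

Lemma zexpD m p : zexp (m + p)%MM = zexp m + zexp p.
Proof. by apply/ffunP => l; rewrite !ffunE mnmDE PoszD. Qed.

Lemma zdegD a b : zdeg (a + b) = zdeg a + zdeg b.
Proof. by rewrite /zdeg -big_split; apply: eq_bigr => l _; rewrite ffunE. Qed.

Lemma zexpMnD m (N M : nat) : zexp (m *+ (N + M)) = zexp (m *+ N) + zexp (m *+ M).
Proof. by apply/ffunP => l; rewrite !ffunE !mulmnE mulnDr PoszD. Qed.

Lemma zdeg_zexp m : zdeg (zexp m) = (mdeg m)%:Z.
Proof. by rewrite mdegE (big_morph Posz PoszD (erefl _)); apply: eq_bigr => l _; rewrite ffunE. Qed.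

Lemma zexp_absz a : (forall l, 0 <= a l) -> a = zexp [multinom `|a l|%N | l < n].
Proof. by move=> a0; apply/ffunP => l; rewrite ffunE mnmE gez0_abs. Qed.

Lemma zcoeff_zexp f m : zcoeff f (zexp m) = f@_m.
Proof.
rewrite /zcoeff -zexp_absz ?eqxx => [|l]; last by rewrite ffunE.
by congr mcoeff; apply/mnmP => l; rewrite mnmE ffunE absz_nat.
Qed.

Lemma zcoeff_neq0 f a : zcoeff f a != 0 -> exists2 m, m \in msupp f & a = zexp m.
Proof.
rewrite /zcoeff; case: ifP => [/eqP aE fa|]; last by rewrite eqxx.
by eexists; last exact: aE; rewrite mcoeff_msupp.
Qed.

Lemma zcoeff_lt0 f a l : a l < 0 -> zcoeff f a = 0.
Proof.
move=> al; apply/eqP; apply: contraTT al => /zcoeff_neq0[m _ ->].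
by rewrite ffunE.
Qed.

Lemma zcoeffB f g a : zcoeff (f - g) a = zcoeff f a - zcoeff g a.
Proof. by rewrite /zcoeff; case: ifP => _; rewrite ?subrr ?mcoeffB. Qed.

Lemma zcoeffZ c f a : zcoeff (c *: f) a = c * zcoeff f a.
Proof. by rewrite /zcoeff; case: ifP => _; rewrite ?mulr0 ?mcoeffZ. Qed.

Lemma zcoeffX m a : zcoeff 'X_[m] a = (a == zexp m)%:R.
Proof.
have [->|am] := eqVneq; first by rewrite zcoeff_zexp mcoeffX eqxx.
apply/eqP; apply: contraNT am => /zcoeff_neq0[p].
by rewrite msuppX inE => /eqP-> ->.
Qed.

Lemma zcoeffXM m f a : zcoeff ('X_[m] * f) (a + zexp m) = zcoeff f a.
Proof.
have [/zcoeff_neq0[p _ ->]|] := boolP (zcoeff f a != 0).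
  by rewrite -zexpD !zcoeff_zexp mulrC addmC mcoeffMX.
rewrite negbK => /eqP fa0; rewrite fa0; apply/eqP.
apply: contraTT isT => /zcoeff_neq0[q]; rewrite mulrC (perm_mem (msuppMX f m)).
case/mapP => p pf -> /eqP; rewrite zexpD addrC (inj_eq (addrI _)) => /eqP aE.
by move: pf; rewrite mcoeff_msupp -zcoeff_zexp -aE fa0 eqxx.
Qed.

Definition face_mnm F : 'X_{1..n} := [multinom (l \in F : nat) | l < n].

Lemma xprodE F : xprod k F = 'X_[face_mnm F].
Proof.
rewrite /xprod [RHS]mpolyXE_id big_mkcond; apply: eq_bigr => l _.
by rewrite mnmE; case: (l \in F).
Qed.

Lemma xprodXn F N : xprod k F ^+ N = 'X_[face_mnm F *+ N].
Proof. by rewrite xprodE mpolyXn. Qed.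

Lemma face_mnmD1 F l : l \in F -> face_mnm F = (face_mnm (F :\ l) + U_(l))%MM.
Proof.
move=> lF; apply/mnmP => i; rewrite mnmDE !mnmE !inE [i == l]eq_sym.
by case: eqP => [<-|_]; rewrite ?lF ?addn0.
Qed.

Lemma mdeg_face F : mdeg (face_mnm F) = #|F|.
Proof. by rewrite mdegE -sum1_card [RHS]big_mkcond; apply: eq_bigr => l _; rewrite mnmE; case: (l \in F). Qed.

Lemma zdeg_face F N : zdeg (zexp (face_mnm F *+ N)) = (N * #|F|)%:Z.
Proof. by rewrite zdeg_zexp mdegMn mdeg_face mulnC. Qed.

Lemma zexp_face F N l : zexp (face_mnm F *+ N) l = (N * (l \in F))%:Z.
Proof. by rewrite ffunE mulmnE mnmE mulnC. Qed.

End Multidegrees.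

(** * Multigraded pieces of the Cech complex of R/I *)

Section Strands.
Variables (k : fieldType) (n : nat).
Local Notation R := {mpoly k[n]}.
Local Notation Zn := {ffun 'I_n -> int}.
Variable I : submodClosed R^o.
Implicit Types (f g : R) (a b : Zn) (m : 'X_{1..n}) (F G : {set 'I_n}).

(** The sets F such that R/I localized at x_F is nonzero in multidegree a: x^a
    must have no denominator outside F, and no multiple of it by a monomial in
    the variables of F may fall in I.  The second condition says this without
    choosing a power of x_F: it quantifies over all ways of filling in the
    coordinates of a in F by natural numbers. *)
Definition strand a : pred {set 'I_n} := fun F =>
  `[< (forall l, l \notin F -> 0 <= a l) /\
      forall m, (forall l, l \notin F -> (m l)%:Z = a l) -> ('X_[m] : R^o) \notin I >].

Lemma strandP a F : reflect ((forall l, l \notin F -> 0 <= a l) /\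
    forall m, (forall l, l \notin F -> (m l)%:Z = a l) -> ('X_[m] : R^o) \notin I)
  (strand a F).
Proof. exact: asboolP. Qed.

Lemma strand_subset a F G : F \subset G -> strand a G ->
  (forall l, l \notin F -> 0 <= a l) -> strand a F.
Proof.
move=> /fintype.subsetP FG /strandP[_ aI] a0; apply/strandP; split=> // m am.
by apply: aI => l lG; apply: am; apply: contra lG; exact: FG.
Qed.

Lemma strand_interval a : interval_closed (strand a).
Proof.
move=> F F' G /fintype.subsetP FF' F'G /strandP[a0 _] DG; apply: strand_subset F'G DG _.
by move=> l lF'; apply: a0; apply: contra lF'; exact: FF'.
Qed.

Lemma mpolyX_mem m p : (m <= p)%MM -> ('X_[m] : R^o) \in I -> ('X_[p] : R^o) \in I.
Proof. by move=> /submK <- mI; rewrite mpolyXD; exact: (rpredZ ('X_[p - m] : R) mI). Qed.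

(** Membership is decided monomial by monomial; this is how the monomiality of
    an ideal enters. *)
Definition msupp_closed : Prop :=
  forall f, (f : R^o) \in I -> forall m, m \in msupp f -> ('X_[m] : R^o) \in I.

Lemma monomial_ideal_msupp : monomial_ideal I -> msupp_closed.
Proof.
move=> [S SI] f /SI[s [sS ->]] m; elim: s sS => [|p s IHs] sS.
  by rewrite big_nil msupp0.
rewrite big_cons => /msuppD_le; rewrite mem_cat => /orP[]; last first.
  by apply: IHs => q qs; apply: sS; rewrite inE qs orbT.
rewrite (perm_mem (msuppMX _ _)) => /mapP[q _ ->].
apply: (@mpolyX_mem p.2); first by apply/mnm_lepP => l; rewrite mnmDE leq_addr.
apply/SI; exists [:: (1, p.2)]; split; last by rewrite big_seq1 mul1r.
by move=> r; rewrite inE => /eqP-> /=; apply: sS; rewrite mem_head.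
Qed.

Hypothesis hI : msupp_closed.

Local Notation B := (quotm I).
Local Notation locB F := (locm B (xprod k F)).

Lemma quotmZ f g : f *: quotm_pi I g = quotm_pi I (f * g).
Proof. by rewrite [RHS](quotm_piZ I f g). Qed.

Lemma quotmB f g : quotm_pi I f - quotm_pi I g = quotm_pi I (f - g).
Proof. by apply/eqP; rewrite subr_eq -quotm_piD subrK. Qed.

Lemma quotm_eq0 f : (quotm_pi I f == 0) = ((f : R^o) \in I).
Proof.
have z : 0 = quotm_pi I 0 by have := quotmB 0 0; rewrite !subrr.
by rewrite z; apply/eqP/idP => [/quotm_eqP|fI]; [|apply/quotm_eqP]; rewrite subr0.
Qed.

Lemma strand_zcoeff0 a F N f : strand a F -> (f : R^o) \in I ->
  zcoeff f (a + zexp (face_mnm F *+ N)) = 0.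
Proof.
move=> /strandP[_ aI] fI; apply/eqP; apply: contraTT isT => /zcoeff_neq0[m mf am].
apply: contraNT (aI m _) => [_|l lF]; first exact: hI fI _ mf.
move/ffunP: am => /(_ l); rewrite [LHS]ffunE zexp_face (negPf lF).
by rewrite muln0 addr0 ffunE.
Qed.

Lemma locB_surj F (u : locB F) :
  exists fN : R * nat, u = Defs.frac (xprod k F) (quotm_pi I fN.1) fN.2.
Proof.
have [q [N ->]] := frac_surj u; have [f ->] := quotm_surj q.
by exists (f, N).
Qed.

(** The coefficient of u at x^a.  Its value is forced to be 0 when F is not in
    the strand, where an arbitrary lift of u to R may well have a nonzero
    coefficient. *)
Definition lcoeff F a (u : locB F) : k :=
  let fN := projT1 (cid (locB_surj u)) in
  if strand a F then zcoeff fN.1 (a + zexp (face_mnm F *+ fN.2)) else 0.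

Lemma lcoeffE F a f N : lcoeff a (Defs.frac (xprod k F) (quotm_pi I f) N) =
  if strand a F then zcoeff f (a + zexp (face_mnm F *+ N)) else 0.
Proof.
rewrite /lcoeff; case: cid => -[g M] /=; case: ifP => // aF.
move=> /frac_eqP[t]; rewrite !quotmZ quotmB quotmZ => /eqP; rewrite quotm_eq0.
move=> /(strand_zcoeff0 (N + M + t)%N aF); rewrite mulrBr zcoeffB => /eqP.
rewrite subr_eq0 !mulrA -!exprD !xprodXn => /eqP.
(* Both sides of the relation are brought to the common denominator
   x_F^(N + M + t). *)
have e K L (h : R) : (K + L = N + M + t)%N ->
    zcoeff ('X_[face_mnm F *+ K] * h) (a + zexp (face_mnm F *+ (N + M + t))) =
    zcoeff h (a + zexp (face_mnm F *+ L)).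
  by move=> <-; rewrite addnC zexpMnD addrA zcoeffXM.
by rewrite (e _ N) 1?(e _ M) //; lia.
Qed.

Lemma lcoeff_is_additive F a : zmod_morphism (@lcoeff F a).
Proof.
move=> u v; have [[f N] /= ->] := locB_surj u; have [[g M] /= ->] := locB_surj v.
have -> : Defs.frac (xprod k F) (quotm_pi I f) N - Defs.frac (xprod k F) (quotm_pi I g) M =
    Defs.frac (xprod k F) (quotm_pi I (xprod k F ^+ M * f - xprod k F ^+ N * g)) (N + M).
  rewrite -quotmB -!quotmZ -scalerN -loc_addE -loc_oppE; by [].
rewrite !lcoeffE; case: ifP => // _; last by rewrite subrr.
rewrite zcoeffB !xprodXn; congr (_ - _).
  by rewrite zexpMnD addrA zcoeffXM.
by rewrite addnC zexpMnD addrA zcoeffXM.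
Qed.
HB.instance Definition _ F a := GRing.isZmodMorphism.Build (locB F) k (@lcoeff F a)
  (@lcoeff_is_additive F a).

(** If G is in the strand but G minus l is not, then a_l < 0, and a class in
    which x_l is not inverted has no term of degree a. *)
Lemma lcoeff_loc_map G l a (u : locB (G :\ l)) : l \in G ->
  lcoeff a (loc_map 'X_l (xprod k G) u) = if strand a G then lcoeff a u else 0.
Proof.
move=> lG; have [[f N] /= ->] := locB_surj u.
rewrite (loc_mapE _ _ (xprodD1 k lG)) quotmZ !lcoeffE; case: ifP => // aG.
rewrite (face_mnmD1 lG) mpolyXn.
have -> : ((face_mnm (G :\ l) + U_(l)) *+ N = face_mnm (G :\ l) *+ N + U_(l) *+ N)%MM.
  by apply/mnmP => i; rewrite !(mulmnE, mnmDE) mulnDl.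
rewrite zexpD addrA zcoeffXM; case: ifPn => // naG.
have [al|al] := leP 0 (a l).
  case/negP: naG; apply: (strand_subset _ aG); first exact: finset.subsetDl.
  move=> i; rewrite !inE negb_and negbK => /orP[/eqP->//|iG].
  by case/strandP: aG => aG _; exact: aG.
by apply: (@zcoeff_lt0 _ _ _ _ l); rewrite ffunE zexp_face !inE eqxx muln0 addr0.
Qed.

Lemma lcoeff_cech_d a (c : cochain B) G :
  lcoeff a (cech_d c G) = subset_d (strand a) (fun F => lcoeff a (c F)) G.
Proof.
rewrite raddf_sum /subset_d /=.
rewrite (eq_bigr (fun l => (if strand a G then lcoeff a (c (G :\ l)) else 0)
    *~ incidence G l)) => [|l lG]; last by rewrite raddfMz /= lcoeff_loc_map.
by case: ifP => // _; rewrite big1 // => l _; rewrite mul0rz.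
Qed.

(** Let u = f / x_F^N.  A monomial x^m of f contributes in degree m - N 1_F; when
    F is not in that strand, some monomial of I agrees with x^m outside F, hence
    divides x^m x_F^t for t large.  So a power of x_F carries f into I. *)
Lemma lcoeff_inj F (u : locB F) : (forall a, lcoeff a u = 0) -> u = 0.
Proof.
have [[f N] /= ->] := locB_surj u => u0.
have H m : exists t, m \in msupp f -> ('X_[m + face_mnm F *+ t] : R^o) \in I.
  have [mf|] := boolP (m \in msupp f); last by exists 0%N.
  pose a := zexp m - zexp (face_mnm F *+ N).
  have aE l : a l = (m l)%:Z - (N * (l \in F))%:Z.
    by rewrite /a !ffunE mulmnE mnmE mulnC.
  have naF : ~~ strand a F.
    apply/negP => aF; have := u0 a; rewrite lcoeffE aF subrK zcoeff_zexp => /eqP.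
    by apply/negP; rewrite -mcoeff_msupp.
  have [p [mp pI]] : exists p : 'X_{1..n}, (forall l, l \notin F -> p l = m l) /\ ('X_[p] : R^o) \in I.
    apply: contrapT => np; case/negP: naF; apply/strandP; split=> [l lF|p pa].
      by rewrite aE (negPf lF) muln0 subr0.
    apply/negP => pI; apply: np; exists p; split=> // l lF.
    by have := pa _ lF; rewrite aE (negPf lF) muln0 subr0 => -[].
  exists (mdeg p) => _; apply: mpolyX_mem pI; apply/mnm_lepP => l.
  rewrite mnmDE mulmnE mnmE; have [lF|lF] := boolP (l \in F); last first.
    by rewrite mp // leq_addr.
  by rewrite mul1n (leq_trans _ (leq_addl _ _)) // mdegE (bigD1 l) ?leq_addr.
have {}H := choice H; case: H => t tI.
pose T := (\sum_(m <- msupp f) t m)%N.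
apply/frac_eqP; exists T; rewrite expr0 scale1r scaler0 subr0 quotmZ; apply/eqP.
rewrite quotm_eq0 xprodXn [f in _ * f]mpolyE mulr_sumr big_seq.
apply: rpred_sum => m mf; rewrite -scalerAr -mpolyXD -mul_mpolyC.
apply: (rpredZ (_ : R) (_ : (_ : R^o) \in I)); apply: mpolyX_mem (tI m mf).
rewrite addmC; apply/mnm_lepP => l; rewrite !mnmDE !mulmnE leq_add2r leq_mul2l.
by rewrite /T (big_rem m mf) leq_addr orbT.
Qed.

Lemma lcoeff_finite F (u : locB F) : exists s : seq Zn, forall a, lcoeff a u != 0 -> a \in s.
Proof.
have [[f N] /= ->] := locB_surj u.
exists [seq zexp m - zexp (face_mnm F *+ N) | m <- msupp f] => a.
rewrite lcoeffE; case: ifP => _; last by rewrite eqxx.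
by move=> /zcoeff_neq0[m mf am]; apply/mapP; exists m; rewrite // -am addrK.
Qed.

Lemma lcoeff_loc_gr F (u : locB F) j a :
  loc_gr (quot_gr I) j u -> lcoeff a u != 0 -> zdeg a = j.
Proof.
move=> [q [N [[f fj <-] ->]]]; rewrite lcoeffE; case: ifP => _; last by rewrite eqxx.
move=> /zcoeff_neq0[m mf /(congr1 (@zdeg n))]; rewrite zdegD zdeg_face zdeg_zexp.
suff -> : (mdeg m)%:Z = j + (N * #|F|)%:Z by move/addIr.
move: fj; rewrite /mpoly_gr; case: (_ + _) => d; last by move=> f0; rewrite f0 msupp0 in mf.
by move=> /dhomogP/(_ m mf) ->.
Qed.

(** The class s x^a.  The exponent N of the denominator only has to be at least
    every - a_l with l in F; the sum of all |a_l| is. *)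
Definition lmono F a (s : k) : locB F :=
  let N := (\sum_l `|a l|)%N in
  Defs.frac (xprod k F)
    (quotm_pi I (s *: 'X_[[multinom `|(a + zexp (face_mnm F *+ N))%R l|%N | l < n]])) N.

Lemma strand_zexp a F (N := (\sum_l `|a l|)%N) : strand a F ->
  a + zexp (face_mnm F *+ N) =
  zexp [multinom `|(a + zexp (face_mnm F *+ N))%R l|%N | l < n].
Proof.
move=> /strandP[a0 _]; apply: zexp_absz => l; rewrite ffunE zexp_face.
have [lF|/a0] := boolP (l \in F); last by rewrite muln0 addr0.
have aN : (`|a l| <= N)%N by rewrite /N (bigD1 l) ?leq_addr.
rewrite muln1 -[a l]opprK addrC subr_ge0 (le_trans (ler_norm _)) // normrN.
by rewrite -abszE lez_nat.
Qed.

Lemma lcoeff_lmono F a b s : (~~ strand a F -> s = 0) ->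
  lcoeff b (lmono F a s) = if b == a then s else 0.
Proof.
rewrite lcoeffE => sa.
have [->|ba] := eqVneq.
  case: ifPn => [aF|/sa->//]; by rewrite zcoeffZ zcoeffX -strand_zexp // eqxx mulr1.
case: ifPn => // bF; rewrite zcoeffZ zcoeffX.
have [aF|/sa->] := boolP (strand a F); last by rewrite mul0r.
by rewrite -strand_zexp // (inj_eq (addIr _)) (negPf ba) mulr0.
Qed.

Lemma loc_gr_lmono F a s : (~~ strand a F -> s = 0) ->
  loc_gr (quot_gr I) (zdeg a) (lmono F a s).
Proof.
move=> sa; rewrite /lmono; set N := (\sum_l `|a l|)%N; set m := Multinom _.
exists (quotm_pi I (s *: 'X_[m])), N; split=> //; exists (s *: 'X_[m]) => //.
have [aF|/sa->] := boolP (strand a F); last first.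
  by rewrite scale0r /mpoly_gr; case: (_ + _) => // d; rewrite dhomog0.
by rewrite -(zdeg_face F N) -zdegD strand_zexp // zdeg_zexp /= dhomogZ // dhomogX.
Qed.

Lemma cocycle_lcoeff i (c : cochain B) :
  cocycle i c <-> forall a, subset_cocycle (strand a) i (fun F => lcoeff a (c F)).
Proof.
split=> [[c0 dc] a|H].
  split=> [F|G]; last by rewrite -lcoeff_cech_d dc raddf0.
  rewrite negb_and => /orP[naF|/c0->]; last exact: raddf0.
  by have [[f N] /= ->] := locB_surj (c F); rewrite lcoeffE (negPf naF).
split=> F; last by apply: lcoeff_inj => a; rewrite lcoeff_cech_d; case: (H a).
move=> Fi; apply: lcoeff_inj => a; case: (H a) => c0 _.
by apply: c0; rewrite (negPf Fi) andbF.
Qed.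

(** A cochain involves finitely many multidegrees, so primitives chosen
    separately in these can be added up. *)
Lemma coboundary_lcoeff i (c : cochain B) :
  coboundary i c <-> forall a, subset_coboundary (strand a) i (fun F => lcoeff a (c F)).
Proof.
split=> [[b [b0 cb]] a|].
  exists (fun F => lcoeff a (b F)); split=> [F|G]; last by rewrite cb lcoeff_cech_d.
  rewrite negb_and => /orP[naF|/b0->]; last exact: raddf0.
  by have [[f N] /= ->] := locB_surj (b F); rewrite lcoeffE (negPf naF).
move=> /choice[b bP].
have [s sP] := choice (fun F => lcoeff_finite (c F)).
pose L := undup (flatten [seq s F | F <- enum {set 'I_n}]).
have LP a F : a \notin L -> lcoeff a (c F) = 0.
  move=> aL; apply/eqP; apply: contraNT aL => /sP aF; rewrite mem_undup.
  by apply/flattenP; exists (s F) => //; apply: map_f; rewrite mem_enum.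
have bs a F : ~~ strand a F -> b a F = 0.
  by move=> naF; case: (bP a) => b0 _; apply: b0; rewrite (negPf naF).
pose e F : locB F := \sum_(a <- L) lmono F a (b a F).
have eE a F : lcoeff a (e F) = if a \in L then b a F else 0.
  rewrite /e raddf_sum /=.
  rewrite (eq_bigr (fun a' => if a == a' then b a' F else 0)) => [|a' _].
    2: by rewrite lcoeff_lmono //; exact: bs.
  rewrite -big_mkcond /=; case: ifPn => aL; last first.
    rewrite big_seq_cond big_pred0 // => a'.
    by apply: contraNF aL => /andP[a'L /eqP->].
  rewrite -big_filter (_ : [seq _ <- _ | _] = [:: a]) ?big_seq1 //.
  rewrite (eq_filter (a2 := pred1 a)) ?filter_pred1_uniq ?undup_uniq //.
exists e; split=> [F Fi|G].
  rewrite /e big1 // => a _; apply: lcoeff_inj => a'; rewrite lcoeff_lmono.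
    case: (bP a) => b0 _; rewrite b0 ?if_same //.
    by rewrite (negPf Fi) andbF.
  exact: bs.
apply/eqP; rewrite -subr_eq0; apply/eqP; apply: lcoeff_inj => a.
rewrite raddfB /= lcoeff_cech_d; have [aL|aL] := boolP (a \in L).
  case: (bP a) => _ ->; apply/eqP; rewrite subr_eq0; apply/eqP.
  by apply: eq_subset_d => F; rewrite eE aL.
rewrite LP // (@eq_subset_d _ _ _ _ (fun=> 0)); last by move=> F; rewrite eE (negPf aL).
by rewrite subset_d0 subrr.
Qed.

Lemma strand_lift a i (s : {set 'I_n} -> k) :
    subset_cocycle (strand a) i s -> ~ subset_coboundary (strand a) i s ->
  exists c : cochain B, [/\ cocycle i c, forall F, loc_gr (quot_gr I) (zdeg a) (c F)
    & ~ coboundary i c].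
Proof.
move=> [s0 ds] ns.
have sa F : ~~ strand a F -> s F = 0 by move=> naF; apply: s0; rewrite (negPf naF).
exists (fun F => lmono F a (s F)); split.
- apply/cocycle_lcoeff => b; have [->|ba] := eqVneq b a.
    split=> [F|G]; first by rewrite lcoeff_lmono ?eqxx; [exact: s0|exact: sa].
    rewrite -(ds G); apply: eq_subset_d => F; by rewrite lcoeff_lmono ?eqxx //; exact: sa.
  split=> [F _|G]; first by rewrite lcoeff_lmono ?(negPf ba) //; exact: sa.
  rewrite (@eq_subset_d _ _ _ _ (fun=> 0)) ?subset_d0 // => F.
  by rewrite lcoeff_lmono ?(negPf ba) //; exact: sa.
- move=> F; apply: loc_gr_lmono; exact: sa.
- move=> /coboundary_lcoeff/(_ a)[b [b0 sb]]; apply: ns; exists b; split=> // G.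
  by rewrite -sb lcoeff_lmono ?eqxx //; exact: sa.
Qed.

Lemma lc_neq0P i : lc_neq0 B i <-> exists a, subset_H_neq0 k (strand a) i.
Proof.
split=> [[c [/cocycle_lcoeff cc ncb]]|[a [s [cs ncb]]]].
  apply: contrapT => nH; apply: ncb; apply/coboundary_lcoeff => a.
  by apply: contrapT => na; apply: nH; exists a, (fun F => lcoeff a (c F)).
by have [c [cc _ nc]] := strand_lift cs ncb; exists c.
Qed.

Lemma lc_gr_neq0P i j :
  lc_gr_neq0 (quot_gr I) i j <-> exists2 a, zdeg a = j & subset_H_neq0 k (strand a) i.
Proof.
split=> [[c [/cocycle_lcoeff cc cj ncb]]|[a <- [s [cs ncb]]]]; last exact: strand_lift cs ncb.
apply: contrapT => nH; apply: ncb; apply/coboundary_lcoeff => a.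
apply: contrapT => na; have [aj|aj] := eqVneq (zdeg a) j.
  by apply: nH; exists a => //; exists (fun F => lcoeff a (c F)).
apply: na; exists (fun=> 0); split=> // G.
by rewrite subset_d0; apply/eqP; apply: contraNT aj => /(lcoeff_loc_gr (cj G)) ->.
Qed.

End Strands.

(** * Strands of I : x and (I, x) *)

Section ColonAdjoin.
Variables (k : fieldType) (n : nat).
Local Notation R := {mpoly k[n]}.
Local Notation Zn := {ffun 'I_n -> int}.
Variables (I : submodClosed R^o) (i : 'I_n).
Implicit Types (f g : R) (a b : Zn) (m : 'X_{1..n}) (F G : {set 'I_n}).

Local Notation Ic := (colon I 'X_i).
Local Notation Ia := (adjoin I 'X_i).
Local Notation e := (zexp U_(i)).

Hypothesis hI : msupp_closed I.

Lemma colonE f : ((f : R^o) \in Ic) = ((f * 'X_i : R^o) \in I).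
Proof. by []. Qed.

Lemma adjoinP f : reflect (exists g h : R, (g : R^o) \in I /\ f = g + h * 'X_i)
  ((f : R^o) \in Ia).
Proof. exact: asboolP. Qed.

Lemma mem_colonX m : (('X_[m] : R^o) \in Ic) = (('X_[m + U_(i)] : R^o) \in I).
Proof. by rewrite colonE -mpolyXD. Qed.

Lemma mnm_subK_U m : m i != 0%N -> (m - U_(i) + U_(i))%MM = m.
Proof. by move=> mi; rewrite submK // lep1mP. Qed.

Lemma mem_adjoinX m : (('X_[m] : R^o) \in Ia) = (m i != 0%N) || (('X_[m] : R^o) \in I).
Proof.
apply/adjoinP/orP => [[g [h [gI mE]]]|[mi|mI]].
- have : m \in msupp ('X_[m] : R) by rewrite msuppX mem_head.
  rewrite [X in msupp X]mE => /msuppD_le; rewrite mem_cat => /orP[mg|]; first by right; exact: (hI gI mg).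
  rewrite (perm_mem (msuppMX _ _)) => /mapP[p _ ->]; left.
  by rewrite mnmDE mnm1E eqxx.
- exists 0, 'X_[m - U_(i)]; rewrite add0r -mpolyXD mnm_subK_U //; split=> //.
  exact: rpred0.
- by exists 'X_[m], 0; rewrite mul0r addr0.
Qed.

Lemma colon_msupp_closed : msupp_closed Ic.
Proof.
move=> f; rewrite colonE => fI m mf; rewrite mem_colonX; apply: hI fI _ _.
by rewrite (perm_mem (msuppMX _ _)) addmC; apply: map_f.
Qed.

Lemma adjoin_msupp_closed : msupp_closed Ia.
Proof.
move=> f /adjoinP[g [h [gI ->]]] m /msuppD_le; rewrite mem_cat mem_adjoinX.
case/orP=> [mg|]; first by rewrite (hI gI mg) orbT.
by rewrite (perm_mem (msuppMX _ _)) => /mapP[p _ ->]; rewrite mnmDE mnm1E eqxx.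
Qed.

Lemma eq_strand (J : submodClosed R^o) a b F :
  (forall l, l \notin F -> a l = b l) -> strand J a F = strand J b F.
Proof.
wlog suff H : a b / (forall l, l \notin F -> a l = b l) -> strand J a F -> strand J b F.
  by move=> ab; apply/idP/idP; apply: H => // l lF; rewrite ab.
move=> ab /strandP[a0 aJ]; apply/strandP; split=> [l lF|m mb].
  by rewrite -ab // a0.
by apply: aJ => l lF; rewrite ab // mb.
Qed.

Lemma zexpUE a l : (a + e) l = a l + (i == l)%:Z.
Proof. by rewrite !ffunE mnm1E. Qed.

Lemma zexpBUE b l : (b - e) l = b l - (i == l)%:Z.
Proof. by rewrite -[in RHS](subrK e b) zexpUE addrK. Qed.

(** When x is inverted, multiplication by x is bijective, so I and I : x have the
    same localization. *)
Lemma strand_colon_in a F : i \in F -> strand Ic a F = strand I a F.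
Proof.
move=> iF; have Ul l : l \notin F -> (i == l) = false.
  by move=> lF; apply: contraNF lF => /eqP<-.
apply/strandP/strandP => -[a0 aI]; split=> // m am.
  have := aI m am; rewrite mem_colonX; apply: contra => mI.
  by apply: mpolyX_mem mI; apply/mnm_lepP => l; rewrite mnmDE leq_addr.
rewrite mem_colonX; apply: aI => l lF.
by rewrite mnmDE mnm1E Ul // addn0 am.
Qed.

Lemma strand_colon_notin a F : i \notin F ->
  strand Ic a F = (0 <= a i) && strand I (a + e) F.
Proof.
move=> iF; apply/strandP/andP => [[a0 aI]|[ai /strandP[a0 aI]]].
  split; first exact: a0.
  apply/strandP; split=> [l lF|m am].
    by rewrite zexpUE addr_ge0 // a0.
  have mi : m i != 0%N.
    by have := am i iF; have := a0 i iF; rewrite zexpUE eqxx; lia.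
  have := aI (m - U_(i))%MM; rewrite mem_colonX mnm_subK_U //; apply=> l lF.
  have := am l lF; rewrite zexpUE mnmBE mnm1E; case: eqP => [<-|_] /=; lia.
split=> [l lF|m am]; last first.
  by rewrite mem_colonX; apply: aI => l lF; rewrite mnmDE mnm1E PoszD am // zexpUE.
have := a0 l lF; rewrite zexpUE; case: eqP => [<-|_]; rewrite ?addr0 //.
Qed.

Lemma strand_colon a :
  strand Ic a =1 strand I (if a i < 0 then a else a + e).
Proof.
move=> F; have [iF|iF] := boolP (i \in F).
  rewrite strand_colon_in //; apply: eq_strand => l lF; case: ifP => // _.
  by rewrite zexpUE; case: eqP => [il|]; rewrite ?addr0 //; rewrite -il iF in lF.
rewrite strand_colon_notin //; case: leP => //= ai.
apply/esym/negP => /strandP[a0 _].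
by have := a0 i iF; rewrite leNgt ai.
Qed.

Lemma strand_colon_shift_neq0 b : b i != 0 -> strand Ic (b - e) =1 strand I b.
Proof.
move=> bi F; have [iF|iF] := boolP (i \in F).
  rewrite strand_colon_in //; apply: eq_strand => l lF.
  rewrite zexpBUE; case: eqP => [il|]; rewrite ?subr0 //.
  by rewrite -il iF in lF.
rewrite strand_colon_notin // subrK.
case: (boolP (strand I b F)) => [/strandP[b0 _]|]; last by rewrite andbF.
by have := b0 i iF; rewrite andbT zexpBUE eqxx; move/eqP: bi; lia.
Qed.

Lemma strand_colon_shift_eq0 b : b i = 0 ->
  strand Ic (b - e) =1 with_pt (strand I b) i.
Proof.
move=> bi F; rewrite /with_pt; have [iF|iF] := boolP (i \in F).
  rewrite andbT strand_colon_in //; apply: eq_strand => l lF.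
  rewrite zexpBUE; case: eqP => [il|]; rewrite ?subr0 //.
  by rewrite -il iF in lF.
rewrite andbF strand_colon_notin //; apply/negP => /andP[+ _].
by rewrite zexpBUE bi eqxx.
Qed.

(** Modulo x only the degrees with a_x = 0 survive, and inverting x kills
    everything. *)
Lemma strand_adjoin a :
  strand Ia a =1 if a i == 0 then without_pt (strand I a) i else pred0.
Proof.
move=> F; have [iF|iF] := boolP (i \in F).
  transitivity false; last by case: ifP; rewrite /without_pt ?iF ?andbF.
  apply/negP => /strandP[a0 aI].
  (* A filling-in of a with a positive exponent at x lies in (I, x). *)
  pose m := [multinom if l == i then 1%N else `|a l|%N | l < n].
  have /negP[] : ('X_[m] : R^o) \notin Ia.
    apply: aI => l lF; rewrite mnmE; case: eqP => [li|_]; first by rewrite li iF in lF.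
    by rewrite gez0_abs // a0.
  by rewrite mem_adjoinX mnmE eqxx.
have [ai|ai] := eqVneq (a i) 0; rewrite /without_pt ?iF ?andbT.
  apply/strandP/strandP => -[a0 aI]; split=> // m am; have := aI m am.
    by rewrite mem_adjoinX negb_or => /andP[].
  move=> mI; rewrite mem_adjoinX negb_or mI negbK andbT.
  by have := am i iF; rewrite ai => -[->].
apply/negP => /strandP[a0 aI].
have := aI [multinom `|a l|%N | l < n]; rewrite mem_adjoinX mnmE absz_eq0 ai /=.
by move=> H; have: false by apply: H => l lF; rewrite mnmE gez0_abs // a0.
Qed.

Definition strand_H (J : submodClosed R^o) p (j : int) : Prop :=
  exists2 a, zdeg a = j & subset_H_neq0 k (strand J a) p.

Lemma zdegU b : zdeg (b - e) = zdeg b - 1.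
Proof. by have := zdegD (b - e) e; rewrite subrK zdeg_zexp mdeg1 => ->; rewrite addrK. Qed.

(** The next three lemmas are the long exact sequence of
    0 -> (R/(I:x))(-1) -> R/I -> R/(I,x) -> 0. *)
Lemma strand_H_quotient p j :
  strand_H I p j -> strand_H Ic p (j - 1) \/ strand_H Ia p j.
Proof.
move=> [b <- H]; have [bi|bi] := eqVneq (b i) 0; last first.
  left; exists (b - e); first exact: zdegU.
  by apply: eq_subset_H_neq0 H => F; rewrite strand_colon_shift_neq0.
case: (subset_H_middle i (strand_interval (a := b)) H) => {}H.
  left; exists (b - e); first exact: zdegU.
  by apply: eq_subset_H_neq0 H => F; rewrite strand_colon_shift_eq0.
right; exists b => //.
by apply: eq_subset_H_neq0 H => F; rewrite strand_adjoin bi eqxx.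
Qed.

Lemma strand_H_adjoin p j :
  strand_H Ia p j -> strand_H I p j \/ strand_H Ic p.+1 (j - 1).
Proof.
move=> [b <- H]; have [bi|bi] := eqVneq (b i) 0; last first.
  case: (@subset_H_neq0_pred0 _ k (strand Ia b) p) => // F.
  by rewrite strand_adjoin (negPf bi).
have {}H : subset_H_neq0 k (without_pt (strand I b) i) p.
  by apply: eq_subset_H_neq0 H => F; rewrite strand_adjoin bi eqxx.
case: (subset_H_right (strand_interval (a := b)) H) => {}H; first by left; exists b.
right; exists (b - e); first exact: zdegU.
by apply: eq_subset_H_neq0 H => F; rewrite strand_colon_shift_eq0.
Qed.

Lemma strand_H_connecting p j :
  strand_H Ic p j ->
  strand_H I p (j + 1) \/ exists2 q, p = q.+1 & strand_H Ia q (j + 1).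
Proof.
move=> [a <-]; rewrite -[a](addrK e); move: (a + e) => b H.
rewrite zdegU subrK; have [bi|bi] := eqVneq (b i) 0; last first.
  left; exists b => //.
  by apply: eq_subset_H_neq0 H => F; rewrite strand_colon_shift_neq0.
have {}H : subset_H_neq0 k (with_pt (strand I b) i) p.
  by apply: eq_subset_H_neq0 H => F; rewrite strand_colon_shift_eq0.
case: (subset_H_left (strand_interval (a := b)) H) => [{}H|[q pq {}H]].
  by left; exists b.
right; exists q => //; exists b => //.
by apply: eq_subset_H_neq0 H => F; rewrite strand_adjoin bi eqxx.
Qed.

(** Unlike the exact sequence, this comparison needs the multigrading: a class of
    R/(I:x) in degree a is one of R/I in degree a or a + e, according to the sign
    of a_x. *)
Lemma strand_H_colon p j :
  strand_H Ic p j -> strand_H I p j \/ strand_H I p (j + 1).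
Proof.
move=> [a <- H]; have {}H := eq_subset_H_neq0 (@strand_colon a) H.
case: ltP H => ai H; first by left; exists a.
by right; exists (a + e); rewrite // zdegD zdeg_zexp mdeg1.
Qed.

End ColonAdjoin.

(** * Bounds of sets of integers, and the two dichotomies *)

Section IntegerBounds.
Local Open Scope ereal_scope.

(** A nonempty set of integers has a maximum if it is bounded above, and +oo is
    its only upper bound otherwise. *)
Lemma supremum_int (T : Type) (P : set T) (f : T -> int) :
  isLub [set (f t)%:E | t in P]%classic
        (supremum -oo [set (f t)%:E | t in P]%classic : \bar int).
Proof.
set S := [set _ | _ in _]%classic; rewrite /supremum.
have [S0|/set0P[_ [t0 Pt0 _]]] := eqVneq S set0.
  by rewrite S0; split=> [? []|u _]; rewrite leNye.
case: xgetP => [s _ //|]; suff [s sS] : exists s, supremums S s by move=> /(_ s).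
have [[M PM]|nM] := pselect (exists M : int, forall t, P t -> (f t <= M)%R); last first.
  exists +oo; split=> [u _|[u|//|] uS]; first by rewrite leey.
    case: nM; exists u => t Pt; rewrite -lee_fin; apply: uS; by exists t.
  by have /= := uS (f t0)%:E (ex_intro2 _ _ t0 Pt0 erefl); rewrite leeNy_eq.
pose Q q := `[< exists2 t, P t & f t = (f t0 + q%:Z)%R >].
have Q0 : exists q, Q q by exists 0%N; apply/asboolP; exists t0; rewrite ?addr0.
have QM q : Q q -> (q <= `|(M - f t0)%R|)%N.
  by move=> /asboolP[t /PM fM fq]; lia.
case: (ex_maxnP Q0 QM) => q /asboolP[t Pt ft] qmax.
exists (f t)%:E; split=> [_ [t' Pt' <-]|u uS]; last by apply: uS; exists t.
rewrite lee_fin; have [//|lt] := leP (f t') (f t0); first by rewrite ft; lia.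
have := qmax `|(f t' - f t0)%R|%N; rewrite ft.
suff: Q `|(f t' - f t0)%R|%N by move=> -> /(_ isT); lia.
by apply/asboolP; exists t' => //; lia.
Qed.

Lemma infimum_nat (P : set nat) (S := [set (p%:Z)%:E | p in P]%classic : set (\bar int)) :
  lbound S (infimum +oo S) /\ forall u, lbound S u -> u <= infimum +oo S.
Proof.
rewrite /infimum.
have [S0|/set0P[_ [t0 Pt0 _]]] := eqVneq S set0.
  by rewrite S0; split=> [? []|u _]; rewrite leey.
case: xgetP => [s _ //|]; suff [s sS] : exists s, infimums S s by move=> /(_ s).
have Q0 : exists q, `[< P q >] by exists t0; apply/asboolP.
case: (ex_minnP Q0) => q /asboolP Pq qmin.
exists (q%:Z)%:E; split=> [_ [t' Pt' <-]|u uS]; last by apply: uS; exists q.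
by rewrite lee_fin lez_nat qmin //; apply/asboolP.
Qed.

End IntegerBounds.

Section Dichotomies.
Local Open Scope ereal_scope.

(** If depth A > depth B = t, then A has no cohomology in degrees up to t, so
    H^t(B) injects into H^t(C), and H^j(C) into H^(j+1)(A) = 0 for j < t; thus
    depth C = t. *)
Lemma depth_dichotomy (tB tA tC : \bar int) :
  tB <= tA -> (tA <= tB \/ tC <= tB) -> (tB <= tC \/ tA - 1%:E <= tC) ->
  tB = tA \/ tB = tC.
Proof.
case: tB tA tC => [b||] [a||] [c||]; rewrite /= -?EFinB ?lee_fin //=;
  try tauto; move=> H1 [] // H2 [] // H3.
all: try ((left; congr EFin; lia) || (right; congr EFin; lia)).
by have [->|ab] := eqVneq a b; [left | right; congr EFin; lia].
Qed.

(** The delicate case is reg A = reg B = r, where B need not force anything on C: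
    a class of A of regularity r cannot map to a nonzero class of B, whose
    regularity would be r + 1, so it comes from C by the connecting map. *)
Lemma reg_dichotomy (sB sA sC : \bar int) :
  (sB <= sA + 1%:E \/ sB <= sC) -> (sC <= sB \/ sC <= sA) ->
  (sA <= sC \/ sA <= sB - 1%:E) -> sA <= sB ->
  sB = sA + 1%:E \/ sB = sC.
Proof.
case: sB sA sC => [b||] [a||] [c||]; rewrite /= -?EFinD -?EFinB ?lee_fin //=;
  try tauto; move=> [] // H1 [] // H2 [] // H3 H4.
all: try ((left; congr EFin; lia) || (right; congr EFin; lia)).
all: have [->|ab] := eqVneq b (a + 1)%R; [by left | right; congr EFin; lia].
Qed.

End Dichotomies.

(** * Depth and regularity *)

Theorem corollary3p3 (k : fieldType) (n : nat)
    (I : submodClosed {mpoly k[n]}^o) (hI : monomial_ideal I) (i : 'I_n) :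
  (depth (quotm I) = depth (quotm (colon I 'X_i)) \/
   depth (quotm I) = depth (quotm (adjoin I 'X_i))) /\
  (reg (quot_gr I) = (reg (quot_gr (colon I 'X_i)) + 1%:E)%E \/
   reg (quot_gr I) = reg (quot_gr (adjoin I 'X_i))).
Proof.
have sI := monomial_ideal_msupp hI.
have sC := colon_msupp_closed (i := i) sI; have sA := adjoin_msupp_closed (i := i) sI.
have lcP (J : submodClosed {mpoly k[n]}^o) : msupp_closed J -> forall p, lc_neq0 (quotm J) p <-> exists j, strand_H J p j.
  move=> sJ p; rewrite lc_neq0P //; split=> [[a Ha]|[j [a _ Ha]]].
    by exists (zdeg a), a.
  by exists a.
have grP (J : submodClosed {mpoly k[n]}^o) : msupp_closed J -> forall p j, lc_gr_neq0 (quot_gr J) p j <-> strand_H J p j.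
  by move=> sJ p j; exact: lc_gr_neq0P.
split.
- have [lbB glbB] := infimum_nat [set p | lc_neq0 (quotm I) p].
  have [lbA glbA] := infimum_nat [set p | lc_neq0 (quotm (colon I 'X_i)) p].
  have [lbC glbC] := infimum_nat [set p | lc_neq0 (quotm (adjoin I 'X_i)) p].
  apply: depth_dichotomy.
  + apply: glbA => _ [p /(lcP _ sC)[j Hj] <-]; apply: lbB; exists p => //.
    by apply/(lcP _ sI); case: (strand_H_colon Hj) => H; eexists; exact: H.
  + apply/orP; rewrite -ge_min; apply: glbB => _ [p /(lcP _ sI)[j Hj] <-].
    rewrite ge_min; apply/orP; case: (strand_H_quotient i sI Hj) => H; [left|right].
      by apply: lbA; exists p => //; apply/(lcP _ sC); eexists; exact: H.
    by apply: lbC; exists p => //; apply/(lcP _ sA); eexists; exact: H.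
  + apply/orP; rewrite -ge_min; apply: glbC => _ [p /(lcP _ sA)[j Hj] <-].
    rewrite ge_min; apply/orP; case: (strand_H_adjoin sI Hj) => H; [left|right].
      by apply: lbB; exists p => //; apply/(lcP _ sI); eexists; exact: H.
    rewrite leeBlDr // -EFinD addrC -intS.
    by apply: lbA; exists p.+1 => //; apply/(lcP _ sC); eexists; exact: H.
- have [ubB lubB] := supremum_int [set ij : nat * int | lc_gr_neq0 (quot_gr I) ij.1 ij.2]
    (fun ij => ij.1%:Z + ij.2).
  have [ubA lubA] := supremum_int
    [set ij : nat * int | lc_gr_neq0 (quot_gr (colon I 'X_i)) ij.1 ij.2]
    (fun ij => ij.1%:Z + ij.2).
  have [ubC lubC] := supremum_int
    [set ij : nat * int | lc_gr_neq0 (quot_gr (adjoin I 'X_i)) ij.1 ij.2]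
    (fun ij => ij.1%:Z + ij.2).
  apply: reg_dichotomy.
  + apply/orP; rewrite -le_max; apply: lubB => _ [[p j] /= /(grP _ sI) Hj <-].
    rewrite le_max; apply/orP; case: (strand_H_quotient i sI Hj) => H; [left|right].
      rewrite -leeBlDr // -EFinB -addrA.
      by apply: ubA; exists (p, j - 1) => //; apply/(grP _ sC).
    by apply: ubC; exists (p, j) => //; apply/(grP _ sA).
  + apply/orP; rewrite -le_max; apply: lubC => _ [[p j] /= /(grP _ sA) Hj <-].
    rewrite le_max; apply/orP; case: (strand_H_adjoin sI Hj) => H; [left|right].
      by apply: ubB; exists (p, j) => //; apply/(grP _ sI).
    apply: ubA; exists (p.+1, j - 1); first exact/(grP _ sC).
    by rewrite /=; congr EFin; lia.
  + apply/orP; rewrite -le_max; apply: lubA => _ [[p j] /= /(grP _ sC) Hj <-].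
    rewrite le_max; apply/orP; case: (strand_H_connecting sI Hj) => [H|[q -> H]]; [right|left].
      rewrite -[leRHS]/(reg (quot_gr I) - 1%:E)%E leeBrDr // -EFinD -addrA.
      by apply: ubB; exists (p, j + 1) => //; apply/(grP _ sI).
    apply: ubC; exists (q, j + 1); first exact/(grP _ sA).
    by rewrite /=; congr EFin; lia.
  + apply: lubA => _ [[p j] /= /(grP _ sC) Hj <-].
    case: (strand_H_colon Hj) => H.
      by apply: ubB; exists (p, j) => //; apply/(grP _ sI).
    apply: (@le_trans _ _ (p%:Z + (j + 1))%:E%E).
      by rewrite lee_fin; lia.
    by apply: ubB; exists (p, j + 1) => //; apply/(grP _ sI).
Qed.
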